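(* Let $\Gamma=(X,R)$ be a bipartite distance-regular graph with diameter $D\ge4$ and valency $k\ge3$, fix $x\in X$, let $W$ be a thin irreducible $T(x)$-module with endpoint $2$ and local eigenvalue $\eta$ with $\tilde\theta_1<\eta<\tilde\theta_d$, and let $v$ be a nonzero vector in $E^*_2W$. Then the vectors $E^*_{i+2}A_iv$ $(0\le i\le D-2)$ form a basis for $W$.
   Context: $\Gamma$ is a finite connected bipartite distance-regular graph with distance $\partial$, intersection numbers $c_i,b_i$; $A_i$ distance matrices, $A=A_1$, eigenvalues $\theta_0>\dots>\theta_D$; $d=\lfloor D/2\rfloor$. $E^*_i$ diagonal with $(y,y)$-entry $1$ if $\partial(x,y)=i$, else $0$; $T(x)$ generated by $A,E^*_0,\dots,E^*_D$; thin: $\dim E^*_iW\le1$ for all $i$; endpoint $\min\{i:E^*_iW\ne0\}$; local eigenvalue of thin irreducible $W$ with endpoint 2: eigenvalue of $E^*_2A_2E^*_2$ on $E^*_2W$. $\tilde\theta_1=-1-b_2b_3(\theta_1^2-b_2)^{-1}$, $\tilde\theta_d=-1-b_2b_3(\theta_d^2-b_2)^{-1}$. *)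

(* Defs.v *)
From mathcomp Require Import all_boot all_order all_algebra.

Set Implicit Arguments.
Unset Strict Implicit.
Unset Printing Implicit Defensive.

Import Order.TTheory GRing.Theory Num.Theory.
Local Open Scope ring_scope.

Section Graph.
Variables (X : finType) (e : rel X).

Definition walk (n : nat) (y z : X) : bool :=
  [exists p : n.-tuple X, path e y p && (last y p == z)].

(* Path-length distance: the least length of a walk from y to z.  In a
   connected graph this is < #|X|; the value #|X| stands for "unreachable". *)
Definition gdist (y z : X) : nat :=
  find (fun n => walk n y z) (iota 0 #|X|).

Definition connected : Prop := forall y z, connect e y z.

Definition diameter : nat := (\max_(y : X) \max_(z : X) gdist y z)%N.

Definition bipartite : Prop :=
  exists f : X -> bool, forall y z, e y z -> f y != f z.

Definition regular (k : nat) : Prop := forall y, #|[set z | e y z]| = k.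

(* p h i j is the intersection number p^h_{ij}. *)
Definition distance_regular (p : nat -> nat -> nat -> nat) : Prop :=
  forall h i j : nat, (h <= diameter)%N -> (i <= diameter)%N ->
    (j <= diameter)%N -> forall y z : X, gdist y z = h ->
    #|[set w | (gdist y w == i) && (gdist z w == j)]| = p h i j.

End Graph.

Definition bnum (p : nat -> nat -> nat -> nat) (i : nat) : nat := p i 1%N i.+1.

Section Terwilliger.
(* The coordinate indexed by i : 'I_#|X| belongs to the vertex enum_val i;
   C^X is 'cV[C]_#|X|, on which matrices act by left multiplication. *)
Variables (C : numClosedFieldType) (X : finType) (e : rel X).

Definition distmx (i : nat) : 'M[C]_#|X| :=
  \matrix_(r, s) (gdist e (enum_val r) (enum_val s) == i)%:R.

Definition adjmx : 'M[C]_#|X| := distmx 1.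

Definition dual_idem (x : X) (i : nat) : 'M[C]_#|X| :=
  diag_mx (\row_r (gdist e x (enum_val r) == i)%:R).

(* The unital subalgebra generated by A, E*_0, ..., E*_D. *)
Inductive in_T (x : X) : 'M[C]_#|X| -> Prop :=
| in_T_adj : in_T x adjmx
| in_T_idem i : (i <= diameter e)%N -> in_T x (dual_idem x i)
| in_T_one : in_T x 1%:M
| in_T_add M N : in_T x M -> in_T x N -> in_T x (M + N)
| in_T_scale a M : in_T x M -> in_T x (a *: M)
| in_T_mul M N : in_T x M -> in_T x N -> in_T x (M *m N).

Implicit Types W U : {vspace 'cV[C]_#|X|}.

Definition T_module (x : X) W : Prop :=
  forall M, in_T x M -> forall w, w \in W -> M *m w \in W.

Definition T_irreducible (x : X) W : Prop :=
  [/\ T_module x W, W != 0%VS &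
      forall U, T_module x U -> (U <= W)%VS -> U = 0%VS \/ U = W].

(* E*_i W *)
Definition subconst (x : X) (i : nat) W : {vspace 'cV[C]_#|X|} :=
  (linfun (mulmx (dual_idem x i)) @: W)%VS.

Definition thin (x : X) W : Prop :=
  forall i, (i <= diameter e)%N -> (\dim (subconst x i W) <= 1)%N.

Definition has_endpoint (x : X) W (r : nat) : Prop :=
  [/\ (r <= diameter e)%N, subconst x r W != 0%VS &
      forall i, (i < r)%N -> subconst x i W = 0%VS].

Definition local_eigenvalue (x : X) W (eta : C) : Prop :=
  exists w, [/\ w \in subconst x 2 W, w != 0 &
    dual_idem x 2 *m distmx 2 *m dual_idem x 2 *m w = eta *: w].

(* theta 0 > ... > theta D are the distinct eigenvalues of A; values of theta
   beyond D are irrelevant. *)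
Definition graph_eigenvalues (theta : nat -> C) : Prop :=
  (forall i j, (i < j)%N -> (j <= diameter e)%N -> theta j < theta i) /\
  (forall a, eigenvalue adjmx a <->
     exists i, (i <= diameter e)%N /\ theta i = a).

End Terwilliger.

Definition tilde (C : numClosedFieldType) (p : nat -> nat -> nat -> nat)
    (t : C) : C :=
  - 1 - (bnum p 2)%:R * (bnum p 3)%:R * (t ^+ 2 - (bnum p 2)%:R)^-1.

(* Main.v *)
(* Put a_i := E*_{i+2} A_i v.  Raising sends a_i to c_{i+1} a_{i+1}, and by
   thinness lowering sends a_{i+1} to a multiple of a_i when a_i != 0, so a_m = q(A) v
   with deg q = m as long as a_0, ..., a_{m-1} are nonzero.  The a_i lie in different
   spheres, so it suffices that none vanishes.  If a_m = 0 with m <= D - 2, then some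
   theta_i with 0 < i < D is not a root of q, and every matrix E with
   E A = theta_i E kills v.  Take E with entries g(dist(y, z)), g the cosine
   sequence of theta_i: since vertices of the second sphere have mutual distances
   0, 2, 4 and v sums to 0 there, E*_2 E v = (g 0 - g 4 + eta (g 2 - g 4)) v, and this
   coefficient is a nonzero multiple of b_2 b_3 + (1 + eta) (theta_i^2 - b_2).
   The bounds on eta say exactly that this is nonzero, because the spectrum is
   symmetric and hence theta_d^2 <= theta_i^2 <= theta_1^2. *)
Require Import Defs.
From mathcomp Require Import all_boot all_order all_algebra zify ring.
Import Order.TTheory GRing.Theory Num.Theory.
Local Open Scope ring_scope.

(** * Path distance in a connected bipartite graph *)

Section GraphDistance.
Set Implicit Arguments.
Unset Strict Implicit.
Variables (X : finType) (e : rel X).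
Local Open Scope nat_scope.

Lemma walkP n y z :
  reflect (exists p : seq X, [/\ size p = n, path e y p & last y p = z])
    (walk e n y z).
Proof.
apply: (iffP existsP) => [[p /andP[yp /eqP pz]] | [p [sp yp pz]]].
  by exists p; rewrite size_tuple.
by exists (tcast sp (in_tuple p)); rewrite val_tcast yp /= pz.
Qed.

Lemma gdist_le n y z : walk e n y z -> gdist e y z <= n.
Proof.
move=> w; have [ltn|] := ltnP n #|X|; last first.
  by apply: leq_trans; rewrite -[leqRHS](size_iota 0) find_size.
rewrite leqNgt; apply/negP => /(before_find 0).
by rewrite nth_iota // add0n w.
Qed.

Hypothesis e_conn : connected e.

Lemma gdist_walk y z : walk e (gdist e y z) y z.
Proof.
have hasw : has (fun n => walk e n y z) (iota 0 #|X|).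
  have /connectP[q yq ->] := e_conn y z.
  (* A repetition-free path has at most [#|X|] vertices, so its length lies in the range searched by
     [gdist]. *)
  have [p yp pu _] := shortenP yq.
  apply/hasP; exists (size p); last by apply/walkP; exists p.
  by rewrite mem_iota add0n; have := max_card (mem (y :: p)); rewrite (card_uniqP pu).
by have:= nth_find 0 hasw; rewrite nth_iota // -{2}(size_iota 0 #|X|) -has_find.
Qed.

Lemma gdist_triangle t y z : gdist e y z <= gdist e y t + gdist e t z.
Proof.
apply: gdist_le; have /walkP[p [sp yp pt]] := gdist_walk y t.
have /walkP[q [sq tq qz]] := gdist_walk t z.
by apply/walkP; exists (p ++ q); rewrite size_cat cat_path last_cat sp sq pt yp.
Qed.

Lemma gdist_eq0 y z : (gdist e y z == 0) = (y == z).
Proof.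
apply/eqP/eqP => [d0|->]; last first.
  by apply/eqP; rewrite -leqn0; apply: gdist_le; apply/walkP; exists [::].
by have /walkP[p [/eqP]] := gdist_walk y z; rewrite d0 size_eq0 => /eqP->.
Qed.

Lemma gdistxx y : gdist e y y = 0.
Proof. by apply/eqP; rewrite gdist_eq0. Qed.

Lemma gdist_prev y z n : gdist e y z = n.+1 ->
  exists2 t, gdist e y t = n & e t z.
Proof.
move=> dn; have /walkP[p []] := gdist_walk y z; rewrite dn.
case/lastP: p => // p t; rewrite size_rcons last_rcons rcons_path.
move=> [sp] /andP[yp ez] tz; exists (last y p); last by rewrite -tz.
apply/eqP; rewrite eqn_leq gdist_le /=; last by apply/walkP; exists p.
rewrite -ltnS -dn (leq_trans (gdist_triangle (last y p) y z)) // -addn1 leq_add2l.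
by apply: gdist_le; apply/walkP; exists [:: t]; rewrite /= ez.
Qed.

Hypotheses (e_sym : symmetric e) (e_irr : irreflexive e) (e_bip : bipartite e).

Lemma gdist_eq1 y z : (gdist e y z == 1) = e y z.
Proof.
apply/eqP/idP => [/gdist_prev[t /eqP] | yz].
  by rewrite gdist_eq0 => /eqP->.
apply/eqP; rewrite eqn_leq gdist_le; last by apply/walkP; exists [:: z]; rewrite /= yz.
by rewrite lt0n gdist_eq0; apply: contraTneq yz => ->; rewrite e_irr.
Qed.

Lemma gdist_sym y z : gdist e y z = gdist e z y.
Proof.
suff le y' z' : gdist e y' z' <= gdist e z' y'.
  by apply/eqP; rewrite eqn_leq !le.
apply: gdist_le; have /walkP[p [sp zp pz]] := gdist_walk z' y'.
apply/walkP; exists (rev (belast z' p)); rewrite size_rev size_belast sp; split=> //.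
  by rewrite -pz rev_path (eq_path (e' := e)).
by case: (p) pz => //= t q _; rewrite rev_cons last_rcons.
Qed.

(** The colour flips along each edge, so the end colours of a walk fix the parity of its length. *)
Lemma odd_gdist : exists f : X -> bool,
  forall y z, odd (gdist e y z) = (f y != f z).
Proof.
have [f fP] := e_bip; exists f => y z.
have /walkP[p [<- yp <-]] := gdist_walk y z.
elim: p y yp => [|t p IH] y /=; first by rewrite eqxx.
move=> /andP[/fP yt /IH ->]; by move: yt; case: (f y); case: (f t); case: (f _).
Qed.

(** The triangle inequality bounds the difference by 1, and parity rules out equality. *)
Lemma gdist_nbr y t z : e t z ->
  (gdist e y z == (gdist e y t).+1) || (gdist e y t == (gdist e y z).+1).
Proof.
move=> tz; have [f fP] := odd_gdist.
have:= gdist_triangle t y z; have := gdist_triangle z y t.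
have:= tz; rewrite -gdist_eq1 (gdist_sym z t) => /eqP dtz; rewrite !dtz !addn1.
rewrite ![_ == _.+1]eqn_leq => -> -> /=.
apply/orP; case: (ltngtP (gdist e y z) (gdist e y t)) => [||yzt]; auto.
have := fP y z; rewrite yzt fP; have:= fP t z; rewrite dtz /=.
by case: (f y); case: (f t); case: (f z).
Qed.

Lemma gdist_diam y z : gdist e y z <= diameter e.
Proof.
apply: leq_trans (leq_bigmax_cond (F := fun y => \max_z gdist e y z) y isT).
exact: (leq_bigmax_cond (F := gdist e y)).
Qed.

(** Stepping back along a shortest walk between two vertices at maximal distance meets every smaller
    distance; [x] makes the graph nonempty. *)
Lemma gdist_attained (x : X) n : n <= diameter e -> exists y z, gdist e y z = n.
Proof.
have X0 : 0 < #|X| by apply/card_gt0P; exists x.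
have [y Ey] := bigop.eq_bigmax (fun y => \max_z gdist e y z) X0.
have [z Ez] := bigop.eq_bigmax (gdist e y) X0.
rewrite /diameter Ey Ez => le_n; exists y.
move: (subnK le_n); set j := _ - n; move: j => j.
elim: j z {Ez le_n} => [|j IH] z; first by exists z.
by rewrite addSn => /esym/gdist_prev[t dt _]; apply: (IH t).
Qed.

End GraphDistance.

(** * Intersection numbers and sums over neighbours *)

Section NeighbourCounts.
Set Implicit Arguments.
Unset Strict Implicit.
Variables (X : finType) (e : rel X) (p : nat -> nat -> nat -> nat) (k : nat).
Hypotheses (e_sym : symmetric e) (e_irr : irreflexive e) (e_conn : connected e).
Hypotheses (e_bip : bipartite e) (e_drg : distance_regular e p).
Hypotheses (e_val : regular e k) (diam_gt0 : (0 < diameter e)%N).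

(* The intersection number c_h, with c_0 = 0. *)
Definition cnum (q : nat -> nat -> nat -> nat) (h : nat) : nat :=
  if h is h'.+1 then q h 1%N h' else 0%N.

Lemma card_nbr_lower y z :
  #|[set t | e z t && (gdist e y z == (gdist e y t).+1)]| =
    cnum p (gdist e y z).
Proof.
case Eh: (gdist e y z) => [|h] /=.
  by apply: eq_card0 => t; rewrite inE andbF.
have h_le : (h.+1 <= diameter e)%N by rewrite -Eh gdist_diam.
rewrite -(e_drg h_le diam_gt0 (ltnW h_le) (y := z) (z := y)); last by rewrite gdist_sym.
by apply: eq_card => t; rewrite !inE gdist_eq1 // eqSS [h == _]eq_sym.
Qed.

(** By bipartiteness a neighbour is closer or farther, never level, whence b_h = k - c_h. The form
    with [cnum] also makes sense at the diameter, where [bnum] is unconstrained. *)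
Lemma card_nbr_upper y z :
  #|[set t | e z t && (gdist e y t == (gdist e y z).+1)]| =
    (k - cnum p (gdist e y z))%N.
Proof.
have := cardsID [set t | gdist e y z == (gdist e y t).+1] [set t | e z t].
have -> : #|[set t | e z t] :&: [set t | gdist e y z == (gdist e y t).+1]| =
    cnum p (gdist e y z).
  by rewrite -card_nbr_lower; apply: eq_card => t; rewrite !inE.
rewrite e_val => <-; rewrite addKn; apply: eq_card => t; rewrite !inE andbC.
case ezt: (e z t) => //=; rewrite ?andbF // andbT.
by have := gdist_nbr e_conn e_sym e_irr e_bip y ezt; lia.
Qed.

Lemma cnum_le y z : (cnum p (gdist e y z) <= k)%N.
Proof.
rewrite -card_nbr_lower -(e_val z); apply: subset_leq_card.
by apply/subsetP => t; rewrite !inE => /andP[].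
Qed.

Lemma cnum_gt0 (x : X) h : (h < diameter e)%N -> (0 < cnum p h.+1)%N.
Proof.
move=> /(gdist_attained e_conn x)[y [z Eh]].
have [t dt ez] := gdist_prev e_conn Eh.
rewrite -Eh -card_nbr_lower; apply/card_gt0P; exists t.
by rewrite inE e_sym ez dt Eh /=.
Qed.

Lemma cnum1 (x : X) : cnum p 1 = 1%N.
Proof.
have [y [z Eh]] := gdist_attained e_conn x diam_gt0.
rewrite -{1}Eh -card_nbr_lower -(cards1 y); apply: eq_card => t; rewrite !inE Eh.
rewrite eqSS [0%N == _]eq_sym gdist_eq0 // [t == y]eq_sym andbC.
by case: eqP => //= <-; rewrite -gdist_eq1 // gdist_sym // Eh.
Qed.

(** Stepping back from a pair at distance h + 1 gives a pair at distance h together with a neighbour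
    that b_h counts. *)
Lemma bnumE (x : X) h : (h < diameter e)%N ->
  [/\ (cnum p h + bnum p h)%N = k & (0 < bnum p h)%N].
Proof.
move=> h_lt; have [y [z Eh]] := gdist_attained e_conn x h_lt.
have [t dt ez] := gdist_prev e_conn Eh.
have Eb : bnum p h = (k - cnum p h)%N.
  rewrite -dt -card_nbr_upper /bnum dt.
  rewrite -(e_drg (ltnW h_lt) diam_gt0 h_lt (y := t) (z := y)); last by rewrite gdist_sym.
  by apply: eq_card => s; rewrite !inE gdist_eq1.
split; first by rewrite Eb subnKC // -dt cnum_le.
rewrite Eb -dt -card_nbr_upper; apply/card_gt0P; exists z.
by rewrite inE ez dt Eh /=.
Qed.

(** The common tool for counting neighbours by distance. At distance 0 the coefficient of the term
    with [.-1] is 0; at the diameter the last coefficient counts an empty set. *)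
Lemma sum_nbr (F : nzRingType) (g : nat -> F) y z :
  \sum_(t | e z t) g (gdist e y t) =
    (cnum p (gdist e y z))%:R * g (gdist e y z).-1
    + (k%:R - (cnum p (gdist e y z))%:R) * g (gdist e y z).+1.
Proof.
rewrite -natrB ?cnum_le // -card_nbr_upper -card_nbr_lower.
rewrite (bigID (fun t => gdist e y z == (gdist e y t).+1)) /=; congr (_ + _).
  rewrite (eq_bigr (fun=> g (gdist e y z).-1)) => [|t /andP[_ /eqP->] //].
  by rewrite sumr_const mulr_natl -(cardsE (fun t => _)).
rewrite (eq_bigl (fun t => e z t && (gdist e y t == (gdist e y z).+1))); last first.
  move=> t /=; case ezt: (e z t) => //=.
  by have := gdist_nbr e_conn e_sym e_irr e_bip y ezt; lia.
rewrite (eq_bigr (fun=> g (gdist e y z).+1)) => [|t /andP[_ /eqP->] //].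
by rewrite sumr_const mulr_natl -(cardsE (fun t => _)).
Qed.

End NeighbourCounts.

(** * A decreasing spectrum closed under negation *)

Section SymmetricSpectrum.
Set Implicit Arguments.
Unset Strict Implicit.
Variables (C : numClosedFieldType) (D : nat) (theta : nat -> C).
Hypothesis theta_dec :
  forall i j, (i < j)%N -> (j <= D)%N -> theta j < theta i.
Hypothesis theta_opp :
  forall i, (i <= D)%N -> exists2 j, (j <= D)%N & theta j = - theta i.

Lemma theta_nincr i j : (i <= j)%N -> (j <= D)%N -> theta j <= theta i.
Proof.
by rewrite leq_eqVlt => /predU1P[->//|ij] jD; apply/ltW/theta_dec.
Qed.

Lemma theta_lt_index i j :
  (i <= D)%N -> (j <= D)%N -> theta j < theta i -> (i < j)%N.
Proof.
move=> iD jD; case: leqP => // ji; move/lt_le_trans/(_ (theta_nincr ji iD)).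
by rewrite ltxx.
Qed.

(** Negation reverses the order. Induction from the largest eigenvalue ([up]) bounds the index of -
    theta_i above by D - i, and induction from the smallest ([down]) bounds it below. *)
Lemma theta_rev i : (i <= D)%N -> theta (D - i)%N = - theta i.
Proof.
have up n j : (n <= D)%N -> (j <= D)%N -> theta j = - theta n -> (j + n <= D)%N.
  elim: n j => [|n IH] j nD jD Ej; first by rewrite addn0.
  have [j' j'D Ej'] := theta_opp (ltnW nD).
  have jj' : (j < j')%N by apply: theta_lt_index => //; rewrite Ej Ej' ltrN2 theta_dec.
  by rewrite addnS -addSn; apply: leq_trans (IH j' (ltnW nD) j'D Ej'); rewrite leq_add2r.
have down m j : (m <= D)%N -> (j <= D)%N -> theta j = - theta (D - m)%N -> (m <= j)%N.
  elim: m j => [//|m IH] j mD jD Ej.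
  have [j' j'D Ej'] := theta_opp (leq_subr m D).
  apply: leq_ltn_trans (IH j' (ltnW mD) j'D Ej') _.
  by apply: theta_lt_index => //; rewrite Ej Ej' ltrN2 theta_dec // ?leq_subr //; lia.
move=> iD; have [j jD Ej] := theta_opp iD; rewrite -Ej; congr theta.
have := up _ _ iD jD Ej; have := down (D - i)%N j (leq_subr _ _) jD.
by rewrite subKn // => /(_ Ej); lia.
Qed.

(** The order on [C] is partial, but theta_i and theta_{D-i} = - theta_i are comparable, so their
    difference 2 theta_i is real. *)
Lemma theta_real i : (i <= D)%N -> theta i \is Num.real.
Proof.
move=> iD; have : theta i - theta (D - i)%N \is Num.real.
  have [le|/ltnW le] := leqP i (D - i); last rewrite -opprB rpredN.
    by apply: ger0_real; rewrite subr_ge0 theta_nincr // leq_subr.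
  by apply: ger0_real; rewrite subr_ge0 theta_nincr.
rewrite theta_rev // opprK -mulr2n -mulr_natl => /(rpredM (rpredVr (realn C 2))).
by rewrite mulKf // pnatr_eq0.
Qed.

(** In the difference of squares, the factor theta_0 + theta_i equals theta_0 - theta_{D-i}, so both
    factors are gaps of the decreasing sequence. The next two bounds factor in the same way. *)
Lemma theta_sqr_lt i : (0 < i < D)%N -> theta i ^+ 2 < theta 0%N ^+ 2.
Proof.
move=> /andP[i0 iD]; rewrite -subr_gt0 subr_sqr mulr_gt0 //.
  by rewrite subr_gt0 theta_dec // ltnW.
by rewrite -[theta i]opprK -theta_rev ?(ltnW iD) // subr_gt0 theta_dec ?leq_subr // subn_gt0.
Qed.

Lemma theta_sqr_le i : (0 < i < D)%N -> theta i ^+ 2 <= theta 1%N ^+ 2.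
Proof.
move=> /andP[i0 iD]; rewrite -subr_ge0 subr_sqr mulr_ge0 //.
  by rewrite subr_ge0 theta_nincr // ltnW.
by rewrite -[theta i]opprK -theta_rev ?(ltnW iD) // subr_ge0 theta_nincr ?leq_subr // subn_gt0.
Qed.

Lemma theta_sqr_ge i : (i <= D)%N -> theta D./2 ^+ 2 <= theta i ^+ 2.
Proof.
(* Replacing i by D - i keeps the square, so i <= d <= D - d may be assumed. *)
wlog i_le : i / (i <= D./2)%N => [wl iD|].
  have [le|gt] := leqP i D./2; first exact: wl.
  by rewrite -[theta i]opprK -theta_rev // sqrrN wl ?leq_subr //; lia.
move=> iD; rewrite -subr_ge0 subr_sqr mulr_ge0 //.
  by rewrite subr_ge0 theta_nincr //; lia.
rewrite -[theta D./2]opprK -theta_rev ?subr_ge0 ?theta_nincr ?leq_subr //; lia.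
Qed.

End SymmetricSpectrum.

(** * Eigenvalues of the adjacency matrix through functions on vertices *)

Section Eigenfunctions.
Set Implicit Arguments.
Unset Strict Implicit.
Variables (C : numClosedFieldType) (X : finType) (e : rel X).
Hypotheses (e_sym : symmetric e) (e_irr : irreflexive e) (e_conn : connected e).
Hypothesis (e_bip : bipartite e).

Lemma sum_vertices (F : X -> C) : \sum_(s < #|X|) F (enum_val s) = \sum_t F t.
Proof.
by rewrite [RHS](reindex (@enum_val X X)) //; apply/onW_bij/enum_val_bij.
Qed.

Lemma adjmx_entry r s : adjmx C e r s = (e (enum_val r) (enum_val s))%:R.
Proof. by rewrite mxE gdist_eq1. Qed.

Lemma sum_delta (P : pred X) (F : X -> C) :
  \sum_t (P t)%:R * F t = \sum_(t | P t) F t.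
Proof.
by rewrite [RHS]big_mkcond; apply: eq_bigr => t _; case: (P t); rewrite ?mul1r ?mul0r.
Qed.

Definition eigenfun (a : C) (w : X -> C) : Prop :=
  (exists y, w y != 0) /\ forall y, \sum_(t | e y t) w t = a * w y.

Lemma eigenvalue_fun a : eigenvalue (adjmx C e) a <-> exists w, eigenfun a w.
Proof.
split=> [/eigenvalueP[u uA u0] | [w [[y wy] wP]]].
  exists (fun y => u 0 (enum_rank y)); split=> [|y].
    have /rV0Pn[r ur] := u0; exists (enum_val r); by rewrite enum_valK.
  have := congr1 (fun M : 'rV_#|X| => M 0 (enum_rank y)) uA; rewrite !mxE => <-.
  rewrite -sum_delta -sum_vertices; apply: eq_bigr => s _.
  by rewrite adjmx_entry enum_rankK enum_valK mulrC e_sym.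
apply/eigenvalueP; exists (\row_s w (enum_val s)); last first.
  by apply/rV0Pn; exists (enum_rank y); rewrite mxE enum_rankK.
apply/rowP => s; rewrite !mxE -wP -sum_delta -sum_vertices; apply: eq_bigr => t _.
by rewrite adjmx_entry mxE mulrC e_sym.
Qed.

(** Changing the sign of an eigenfunction on one colour class negates its eigenvalue, because every
    edge joins the two classes. *)
Lemma eigenvalue_opp a : eigenvalue (adjmx C e) a -> eigenvalue (adjmx C e) (- a).
Proof.
have [f fP] := e_bip; move=> /eigenvalue_fun[w [[y wy] wP]]; apply/eigenvalue_fun.
exists (fun y => (-1) ^+ f y * w y); split=> [|z].
  by exists y; rewrite mulf_neq0 // signr_eq0.
rewrite mulrCA mulNr -wP mulrN -mulNr mulr_sumr; apply: eq_bigr => t /fP.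
by case: (f z); case: (f t) => // _; rewrite ?opprK.
Qed.

Variables (k : nat) (e_val : regular e k).

Lemma eigenvalue_valency (x : X) : eigenvalue (adjmx C e) k%:R.
Proof.
apply/eigenvalue_fun; exists (fun=> 1); split; first by exists x; rewrite oner_eq0.
by move=> y; rewrite sumr_const mulr1 -(e_val y) cardsE.
Qed.

(** Compare the sums of absolute values: in the sum over all neighbourhoods each vertex occurs k
    times. *)
Lemma eigenvalue_norm a : eigenvalue (adjmx C e) a -> `|a| <= k%:R.
Proof.
move=> /eigenvalue_fun[w [[y wy] wP]].
have S0 : 0 < \sum_z `|w z|.
  rewrite (bigD1 y) //= ltr_pwDl ?normr_gt0 //.
  by apply: sumr_ge0 => z _; apply: normr_ge0.
rewrite -(ler_pM2r S0) !mulr_sumr.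
have -> : \sum_z k%:R * `|w z| = \sum_z \sum_(t | e z t) `|w t|.
  rewrite (exchange_big_dep predT) //=; apply: eq_bigr => t _.
  by rewrite sumr_const mulr_natl -(e_val t) cardsE; congr (_ *+ _); apply: eq_card => s; apply: e_sym.
by apply: ler_sum => z _; rewrite -normrM -wP ler_norm_sum.
Qed.

End Eigenfunctions.

(** * Cosine sequences and their action on the second sphere *)

Section RadialEigenvectors.
Set Implicit Arguments.
Unset Strict Implicit.
Variables (C : numClosedFieldType) (X : finType) (e : rel X).
Variables (p : nat -> nat -> nat -> nat) (k : nat).
Hypotheses (e_sym : symmetric e) (e_irr : irreflexive e) (e_conn : connected e).
Hypotheses (e_bip : bipartite e) (e_drg : distance_regular e p).
Hypotheses (e_val : regular e k) (diam_gt0 : (0 < diameter e)%N).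

(** The recurrence of the cosine sequence of [a], without normalising [g 0]. *)
Definition radial_rec (a : C) (g : nat -> C) : Prop :=
  forall h, (h <= diameter e)%N ->
    (cnum p h)%:R * g h.-1 + (k%:R - (cnum p h)%:R) * g h.+1 = a * g h.

(* The sums of an eigenfunction over the spheres around a vertex satisfy the
   transposed recurrence; dividing by the sphere sizes [kap] transposes it back. *)
Lemma radial_eigenfun a : eigenvalue (adjmx C e) a ->
  exists2 g, g 0%N != 0 & radial_rec a g.
Proof.
move=> /(eigenvalue_fun e_sym e_irr e_conn)[w [[y wy] wP]].
pose f j := \sum_z (gdist e y z == j)%:R * w z.
pose b h : C := k%:R - (cnum p h)%:R.
have fP j : a * f j = (cnum p j.+1)%:R * f j.+1 + (if j is i.+1 then b i * f i else 0).
  (* After exchanging sums, each vertex t is weighted by the number of its neighbours in sphere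
     j. *)
  have -> : a * f j =
      \sum_t (\sum_(z | e t z) (gdist e y z == j)%:R) * w t.
    rewrite mulr_sumr; under [RHS]eq_bigr do rewrite mulr_suml.
    rewrite (exchange_big_dep predT) //=; apply: eq_bigr => z _.
    by rewrite mulrCA -wP mulr_sumr; apply: eq_bigl => t; apply: e_sym.
  under eq_bigr do
    rewrite (sum_nbr e_sym e_irr e_conn e_bip e_drg e_val diam_gt0 (fun i => (i == j)%:R)).
  case: j => [|j]; rewrite /f ?addr0 !mulr_sumr -?big_split /=.
    apply: eq_bigr => t _; case: (gdist e y t) => [|h] /=.
      by rewrite mul0r mulr0 addr0 !mul0r mulr0.
    by rewrite eqSS mulr0 addr0 mulrA; case: eqP => [->|_]; rewrite ?mulr0 ?mul0r.
  apply: eq_bigr => t _; rewrite mulrDl -!mulrA; congr (_ + _).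
    case: (gdist e y t) => [|h] /=; first by rewrite !mul0r mulr0.
    by rewrite eqSS; case: eqP => [->|_]; rewrite ?mul0r ?mulr0.
  by rewrite eqSS; case: eqP => [->|_]; rewrite ?mul0r ?mulr0.
have c0 j : (j < diameter e)%N -> (cnum p j.+1)%:R != 0 :> C.
  move=> jD; rewrite pnatr_eq0 -lt0n.
  exact: (cnum_gt0 e_sym e_irr e_conn e_drg diam_gt0 y).
have b0 j : (j < diameter e)%N -> b j != 0.
  rewrite /b => /(bnumE e_sym e_irr e_conn e_bip e_drg e_val diam_gt0 y)[<- bj].
  by rewrite natrD addrC addKr pnatr_eq0 -lt0n.
(* The balance kap_i b_i = kap_{i+1} c_{i+1} is what interchanges the roles of b and c. *)
pose kap := fix kap j : C := if j is i.+1 then kap i * b i / (cnum p i.+1)%:R else 1.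
have kap0 j : (j <= diameter e)%N -> kap j != 0.
  elim: j => [|j IH] jD; first exact: oner_neq0.
  by rewrite /= !mulf_neq0 ?invr_eq0 ?c0 ?b0 ?IH // ltnW.
exists (fun j => f j / kap j).
  rewrite divr1 /f (bigD1 y) //= big1 ?addr0 ?gdistxx ?mul1r // => z.
  by rewrite gdist_eq0 // eq_sym => /negPf->; rewrite mul0r.
move=> h hD; have up : b h * (f h.+1 / kap h.+1) = (cnum p h.+1)%:R * f h.+1 / kap h.
  have [hlt|hge] := ltnP h (diameter e).
    by rewrite /=; field; rewrite c0 ?b0 ?kap0.
  (* At the diameter the next sphere is empty, so both sides vanish. *)
  suff -> : f h.+1 = 0 by rewrite !(mul0r, mulr0).
  apply: big1 => z _; case: eqP => [Ez|_]; last exact: mul0r.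
  by have := gdist_diam e y z; rewrite Ez ltnNge hge.
rewrite -/(b h) up [RHS]mulrA fP mulrDl addrC; congr (_ + _).
case: h hD {up} => [|h] hD /=; first by rewrite !mul0r.
by field; rewrite c0 ?b0 ?kap0 // ltnW.
Qed.

(** Eliminate g_4, g_3, g_2, g_1 in turn, leaving multiples of g_0. The factor k^2 - a^2 vanishes at
    the trivial eigenvalues k and -k; for a^2 different from b_2, the last factor vanishes exactly
    when [eta] is the [tilde] value of [a]. *)
Lemma radial_closed_form (a eta : C) g (c2 b2 c3 b3 : C) :
  k%:R != 0 :> C -> k%:R - 1 != 0 :> C -> b2 != 0 -> b3 != 0 ->
  c2 + b2 = k%:R -> c3 + b3 = k%:R ->
  k%:R * g 1%N = a * g 0%N -> g 0%N + (k%:R - 1) * g 2%N = a * g 1%N ->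
  c2 * g 1%N + b2 * g 3%N = a * g 2%N -> c3 * g 2%N + b3 * g 4%N = a * g 3%N ->
  (g 0%N - g 4%N + eta * (g 2%N - g 4%N)) * (k%:R * (k%:R - 1) * b2 * b3) =
    g 0%N * (k%:R ^+ 2 - a ^+ 2) * (b2 * b3 + (1 + eta) * (a ^+ 2 - b2)).
Proof.
move=> k0 k1 b20 b30 E2 E3 R0 R1 R2 R3.
have -> : g 4%N = (a * g 3%N - c3 * g 2%N) / b3 by rewrite -R3; field.
have -> : g 3%N = (a * g 2%N - c2 * g 1%N) / b2 by rewrite -R2; field.
have -> : g 2%N = (a * g 1%N - g 0%N) / (k%:R - 1) by rewrite -R1; field.
have -> : g 1%N = a * g 0%N / k%:R by rewrite -R0; field.
have -> : c2 = k%:R - b2 by rewrite -E2 addrK.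
have -> : c3 = k%:R - b3 by rewrite -E3 addrK.
by field; rewrite k0 k1 b20 b30.
Qed.

Definition radialmx (g : nat -> C) : 'M[C]_#|X| :=
  \matrix_(r, s) g (gdist e (enum_val r) (enum_val s)).

Lemma radialmx_adj a g : radial_rec a g -> radialmx g *m adjmx C e = a *: radialmx g.
Proof.
move=> gP; apply/matrixP => r s; rewrite !mxE -gP ?gdist_diam //.
rewrite -(sum_nbr e_sym e_irr e_conn e_bip e_drg e_val diam_gt0) -[RHS]sum_delta -[RHS]sum_vertices.
by apply: eq_bigr => t _; rewrite adjmx_entry // mxE mulrC e_sym.
Qed.

(* Two vertices of the second sphere are at distance 0, 2 or 4. *)
Lemma radialmx_sphere2 (x : X) (v : 'cV[C]_#|X|) (eta : C) g :
  dual_idem C e x 2 *m v = v -> \sum_s v s 0 = 0 ->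
  dual_idem C e x 2 *m distmx C e 2 *m dual_idem C e x 2 *m v = eta *: v ->
  dual_idem C e x 2 *m radialmx g *m v =
    (g 0%N - g 4%N + eta * (g 2%N - g 4%N)) *: v.
Proof.
move=> v2 sum_v; rewrite -!mulmxA v2 => eta_v.
have v_out s : gdist e x (enum_val s) != 2%N -> v s 0 = 0.
  by move=> /negPf ns; rewrite -v2 mul_diag_mx !mxE ns mul0r.
apply/colP => r; rewrite mul_diag_mx !mxE.
case: eqP => [xr|/eqP/v_out ->]; last by rewrite mul0r mulr0.
have eta_r : \sum_s (gdist e (enum_val r) (enum_val s) == 2%N)%:R * v s 0 = eta * v r 0.
  have := congr1 (fun M : 'cV_#|X| => M r 0) eta_v.
  rewrite mul_diag_mx !mxE xr eqxx mul1r => <-.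
  by apply: eq_bigr => s _; rewrite mxE.
have v_r : \sum_s (s == r)%:R * v s 0 = v r 0.
  rewrite (bigD1 r) //= eqxx mul1r big1 ?addr0 // => s /negPf->.
  by rewrite mul0r.
rewrite mul1r.
(* On distances 0, 2, 4 the kernel g is the constant g_4 plus corrections at distances 0 and 2; the
   constant part contributes nothing because v sums to 0. *)
have -> : (g 0%N - g 4%N + eta * (g 2%N - g 4%N)) * v r 0 =
    g 4%N * (\sum_s v s 0) + (g 0%N - g 4%N) * v r 0 + (g 2%N - g 4%N) * (eta * v r 0).
  by rewrite sum_v; ring.
rewrite -eta_r -[in RHS]v_r !mulr_sumr -!big_split /=; apply: eq_bigr => s _.
rewrite mxE; have [xs|/v_out->] := eqVneq (gdist e x (enum_val s)) 2%N; last by rewrite !mulr0 !addr0.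
have := gdist_triangle e_conn x (enum_val r) (enum_val s).
rewrite (gdist_sym e_conn e_sym _ x) xr xs.
have [f fP] := odd_gdist e_conn e_bip.
have : ~~ odd (gdist e (enum_val r) (enum_val s)).
  have := fP x (enum_val r); have := fP x (enum_val s); rewrite xr xs fP.
  by case: (f x); case: (f (enum_val r)); case: (f _).
have := gdist_eq0 e_conn (enum_val r) (enum_val s).
rewrite (inj_eq enum_val_inj) eq_sym [s == r]eq_sym => <-.
by case: (gdist e _ _) => [|[|[|[|[|n]]]]] //= _ _; ring.
Qed.

(** The witness is [radialmx g]. If it killed [v], the closed form would make g_0, k^2 - a^2 or the
    factor containing [eta] vanish; diameter above 3 keeps b_2 and b_3 nonzero. *)
Lemma eigenmx_nonzero (x : X) (v : 'cV[C]_#|X|) (eta a : C) :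
  (3 < diameter e)%N -> eigenvalue (adjmx C e) a -> a ^+ 2 != k%:R ^+ 2 ->
  (bnum p 2)%:R * (bnum p 3)%:R + (1 + eta) * (a ^+ 2 - (bnum p 2)%:R) != 0 ->
  v != 0 -> dual_idem C e x 2 *m v = v -> \sum_s v s 0 = 0 ->
  dual_idem C e x 2 *m distmx C e 2 *m dual_idem C e x 2 *m v = eta *: v ->
  exists2 E : 'M[C]_#|X|, E *m adjmx C e = a *: E & E *m v != 0.
Proof.
move=> D3 a_eig a_k a_eta v0 v2 v_sum eta_v.
have [g g0 gP] := radial_eigenfun a_eig.
exists (radialmx g); first exact: radialmx_adj.
apply/eqP => Ev0; have := radialmx_sphere2 g v2 v_sum eta_v.
rewrite -mulmxA Ev0 mulmx0 => /esym/eqP; rewrite scaler_eq0 (negPf v0) orbF => /eqP gE.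
have bE h (hD : (h <= 3)%N) : (cnum p h)%:R + (bnum p h)%:R = k%:R :> C /\ (bnum p h)%:R != 0 :> C.
  have [<- b0] := bnumE e_sym e_irr e_conn e_bip e_drg e_val diam_gt0 x (leq_ltn_trans hD D3).
  by rewrite natrD pnatr_eq0 -lt0n.
have [E0 b0] := bE 0%N isT; have [E1 b1] := bE 1%N isT.
have [E2 b2] := bE 2%N isT; have [E3 b3] := bE 3%N isT.
have c1 : (cnum p 1)%:R = 1 :> C by rewrite (cnum1 e_sym e_irr e_conn e_drg diam_gt0 x).
have R h (hD : (h <= 3)%N) : (cnum p h)%:R * g h.-1 + (bnum p h)%:R * g h.+1 = a * g h.
  by rewrite -gP ?(leq_trans hD (ltnW D3)) //; have [<- _] := bE h hD; rewrite addrAC subrr add0r.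
have k0 : k%:R != 0 :> C by rewrite -E0 add0r.
have k1 : k%:R - 1 = (bnum p 1)%:R :> C by rewrite -E1 c1 addrC addKr.
have R0 : k%:R * g 1%N = a * g 0%N by rewrite -(R 0%N isT) -E0 /= !(mul0r, add0r).
have R1 : g 0%N + (k%:R - 1) * g 2%N = a * g 1%N by rewrite k1 -(R 1%N isT) c1 mul1r.
have := radial_closed_form eta k0 _ b2 b3 E2 E3 R0 R1 (R 2%N isT) (R 3%N isT).
rewrite k1 gE mul0r => /(_ b1)/esym/eqP; rewrite !mulf_eq0 (negPf g0) (negPf a_eta) orbF.
by rewrite subr_eq0 eq_sym (negPf a_k).
Qed.

End RadialEigenvectors.

(** * Raising and lowering in a thin module with endpoint 2 *)

Section ThinModule.
Set Implicit Arguments.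
Unset Strict Implicit.
Variables (C : numClosedFieldType) (X : finType) (e : rel X).
Variables (p : nat -> nat -> nat -> nat) (k : nat) (x : X).
Variable W : {vspace 'cV[C]_#|X|}.
Hypotheses (e_sym : symmetric e) (e_irr : irreflexive e) (e_conn : connected e).
Hypotheses (e_bip : bipartite e) (e_drg : distance_regular e p).
Hypotheses (e_val : regular e k) (diam_gt1 : (1 < diameter e)%N).
Hypotheses (W_mod : T_module e x W) (W_thin : thin e x W).
Hypothesis W_end : has_endpoint e x W 2.

Local Notation Es := (dual_idem C e x).
Local Notation A := (adjmx C e).
Local Notation c i := ((cnum p i)%:R : C).
Let diam_gt0 : (0 < diameter e)%N := ltnW diam_gt1.

Lemma dual_idemE i (u : 'cV[C]_#|X|) r :
  (Es i *m u) r 0 = (gdist e x (enum_val r) == i)%:R * u r 0.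
Proof. by rewrite mul_diag_mx !mxE. Qed.

Lemma dual_idemM i j (u : 'cV[C]_#|X|) :
  Es i *m (Es j *m u) = if i == j then Es j *m u else 0.
Proof.
apply/colP => r; rewrite !dual_idemE; have [->|nij] := eqVneq i j.
  by rewrite dual_idemE; case: eqP; rewrite ?mul1r ?mul0r.
rewrite mxE; case: eqP => [->|_]; last by rewrite mul0r.
by rewrite (negPf nij) mul0r mulr0.
Qed.

Lemma sum_dual_idem (u : 'cV[C]_#|X|) :
  u = \sum_(i < (diameter e).+1) Es i *m u.
Proof.
apply/colP => r; rewrite summxE.
under eq_bigr do rewrite dual_idemE.
have lt_d : (gdist e x (enum_val r) < (diameter e).+1)%N by rewrite ltnS gdist_diam.
rewrite (bigD1 (Ordinal lt_d)) //= eqxx mul1r big1 ?addr0 // => i ni.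
have /negPf-> : gdist e x (enum_val r) != i by rewrite eq_sym.
by rewrite mul0r.
Qed.

Lemma dual_idem_mem i u : (i <= diameter e)%N -> u \in W -> Es i *m u \in W.
Proof. by move=> iD; apply: W_mod; apply: in_T_idem. Qed.

Lemma adj_mem u : u \in W -> A *m u \in W.
Proof. by apply: W_mod; apply: in_T_adj. Qed.

Lemma mem_subconst i u : (i <= diameter e)%N ->
  (u \in subconst e x i W) = (u \in W) && (Es i *m u == u).
Proof.
move=> iD; apply/memv_imgP/andP => [[t tW ->]|[uW /eqP Eu]].
  by rewrite lfunE /= dual_idemM eqxx; split=> //; rewrite dual_idem_mem.
by exists u => //; rewrite lfunE /= Eu.
Qed.

Lemma subconst_line i u w : (i <= diameter e)%N -> u != 0 ->
  u \in subconst e x i W -> w \in subconst e x i W -> exists a, w = a *: u.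
Proof.
move=> iD u0 uW wW; apply/vlineP; suff /eqP-> : <[u]>%VS == subconst e x i W by [].
by rewrite eqEdim -memvE uW dim_vline u0 W_thin.
Qed.

(** No edge stays inside a sphere, so [A] moves sphere j + 1 into its two neighbouring spheres
    only. *)
Lemma adj_sphere j (u : 'cV[C]_#|X|) : Es j.+1 *m u = u ->
  A *m u = Es j.+2 *m (A *m u) + Es j *m (A *m u).
Proof.
move=> uj; apply/colP => r; rewrite [RHS]mxE !dual_idemE -mulrDl.
set d := gdist e x (enum_val r); suff [-> | ->] : (d == j.+2)%:R + (d == j)%:R = 1 :> C \/ (A *m u) r 0 = 0.
- by rewrite mul1r.
- by rewrite mulr0.
have [->|d2] := eqVneq d j.+2.
  by left; rewrite (_ : (j.+2 == j) = false) ?mulr0n ?addr0 //; lia.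
have [_|d0] := eqVneq d j; first by left; rewrite mulr0n add0r.
right; rewrite mxE big1 // => s _; rewrite adjmx_entry // -uj dual_idemE.
case ers: (e _ _); rewrite ?mul0r // mul1r.
have := gdist_nbr e_conn e_sym e_irr e_bip x ers; rewrite -/d => nbr.
have /negPf-> : gdist e x (enum_val s) != j.+1 by move: d0 d2 nbr; lia.
by rewrite mul0r.
Qed.

Variable v : 'cV[C]_#|X|.
Hypothesis v_in : v \in subconst e x 2 W.
Local Notation a i := (Es (i + 2)%N *m distmx C e i *m v).

Let v2 : Es 2 *m v = v.
Proof. by move: v_in; rewrite mem_subconst // => /andP[_ /eqP]. Qed.

Let v_out s : gdist e x (enum_val s) != 2%N -> v s 0 = 0.
Proof. by move=> /negPf ns; rewrite -v2 dual_idemE ns mul0r. Qed.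

Lemma a0E : a 0 = v.
Proof.
rewrite -mulmxA (_ : distmx C e 0 = 1%:M) ?mul1mx //.
by apply/matrixP => r s; rewrite !mxE gdist_eq0 // (inj_eq enum_val_inj).
Qed.

Lemma sphere_a i : Es (i + 2)%N *m a i = a i.
Proof. by rewrite -mulmxA dual_idemM eqxx. Qed.

(* If dist(x, r) = i + 3 and dist(x, t) = 2, a neighbour of r at distance i from t
   is automatically in the sphere of radius i + 2 around x. *)
Lemma raise_a i : Es i.+3 *m (A *m a i) = c i.+1 *: a i.+1.
Proof.
apply/colP => r; rewrite [RHS]mxE -!mulmxA !dual_idemE addSn addn2.
case: eqP => [xr|_]; last by rewrite !mul0r mulr0.
rewrite !mul1r [LHS]mxE [X in _ = _ * X]mxE mulr_sumr.
under eq_bigr do rewrite dual_idemE [X in _ * (_ * X)]mxE !mulr_sumr.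
rewrite exchange_big /=; apply: eq_bigr => t _; rewrite [distmx _ _ _ _ _]mxE.
have [xt|/v_out->] := eqVneq (gdist e x (enum_val t)) 2%N; last first.
  by rewrite !mulr0 big1 // => s _; rewrite !mulr0.
have := gdist_triangle e_conn (enum_val t) x (enum_val r); rewrite xr xt => le_h.
rewrite mulrA.
transitivity ((\sum_(s | e (enum_val r) s) (gdist e (enum_val t) s == i)%:R) * v t 0).
  rewrite -[X in _ = X * _]sum_delta -[X in _ = X * _]sum_vertices mulr_suml; apply: eq_bigr => s _.
  rewrite adjmx_entry // [distmx _ _ _ _ _]mxE (gdist_sym e_conn e_sym (enum_val t)) -!mulrA.
  case ers: (e _ _); last by rewrite !mul0r.
  rewrite !mul1r.
  have [ts|_] := eqVneq (gdist e (enum_val s) (enum_val t)) i; last first.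
    by rewrite !(mul0r, mulr0).
  rewrite !mul1r.
  have := gdist_triangle e_conn (enum_val t) x (enum_val s).
  have := gdist_triangle e_conn (enum_val s) x (enum_val r).
  rewrite xt xr (gdist_sym e_conn e_sym (enum_val t)) ts.
  have -> : gdist e (enum_val s) (enum_val r) = 1%N by apply/eqP; rewrite gdist_eq1 // e_sym.
  move=> h1 h2; have -> : gdist e x (enum_val s) = i.+2 by lia.
  by rewrite eqxx mul1r.
rewrite (sum_nbr e_sym e_irr e_conn e_bip e_drg e_val diam_gt0 (fun j => (j == i)%:R)).
congr (_ * _); rewrite (gdist_sym e_conn e_sym (enum_val r)).
(* As dist(t, r) >= i + 1, no neighbour of r farther from t can be at distance i; only the c-term
   survives. *)
case: (gdist e _ _) le_h => [|h] le_h; first by lia.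
have -> : (h.+2 == i) = false by lia.
by rewrite eqSS mulr0 addr0 /=; case: eqP => [->|]; rewrite ?mulr0.
Qed.

(** Raising builds these vectors from [v] using only [A] and the dual idempotents, since c_{i+1} can
    be divided out. *)
Lemma a_in i : (i + 2 <= diameter e)%N -> a i \in subconst e x (i + 2) W.
Proof.
move=> iD; rewrite mem_subconst // sphere_a eqxx andbT.
elim: i iD => [|i IH] iD.
  by rewrite a0E; move: v_in; rewrite mem_subconst // => /andP[].
have ci : c i.+1 != 0.
  by rewrite pnatr_eq0 -lt0n (cnum_gt0 e_sym e_irr e_conn e_drg diam_gt0 x) //; lia.
rewrite -[a _](scalerK ci) -raise_a memvZ // -addn3.
apply: dual_idem_mem; first by lia.
by apply/adj_mem/IH; lia.
Qed.

Lemma lower_a0 : Es 1 *m (A *m v) = 0.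
Proof.
have [_ _ /(_ 1%N isT) W1] := W_end; apply/eqP; rewrite -memv0 -W1.
rewrite mem_subconst // dual_idemM eqxx eqxx andbT.
apply/dual_idem_mem/adj_mem => //.
by move: v_in; rewrite mem_subconst // => /andP[].
Qed.

(** By thinness the nonzero vector [a i] spans E*_{i+2} W, which contains the lowered vector. *)
Lemma lower_a i : (i.+1 + 2 <= diameter e)%N -> a i != 0 ->
  exists b, Es i.+2 *m (A *m a i.+1) = b *: a i.
Proof.
move=> iD ai0; apply: (@subconst_line (i + 2)) => //; try by lia.
  by apply: a_in; lia.
have i2 : (i + 2 == i.+2)%N by rewrite addn2.
rewrite mem_subconst; last by lia.
rewrite dual_idemM i2 eqxx andbT.
apply: dual_idem_mem; first by lia.
by apply: adj_mem; have := a_in iD; rewrite mem_subconst // => /andP[].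
Qed.

(** E*_0 A^2 v lies in E*_0 W = 0, and its coordinate at [x] is c_2 times the sum, since x and a
    vertex at distance 2 have c_2 common neighbours. *)
Lemma sum_v : \sum_s v s 0 = 0.
Proof.
have [_ _ /(_ 0%N isT) W0] := W_end.
have vW : v \in W by move: v_in; rewrite mem_subconst // => /andP[].
have /eqP : Es 0 *m (A *m (A *m v)) = 0.
  apply/eqP; rewrite -memv0 -W0 mem_subconst // dual_idemM eqxx eqxx andbT.
  by apply: dual_idem_mem => //; do 2!apply: adj_mem.
move=> /eqP/colP/(_ (enum_rank x)); rewrite dual_idemE enum_rankK gdistxx // mul1r.
have c20 : c 2 != 0.
  by rewrite pnatr_eq0 -lt0n (cnum_gt0 e_sym e_irr e_conn e_drg diam_gt0 x).
rewrite [LHS]mxE [RHS]mxE; under eq_bigr do rewrite [X in _ * X]mxE mulr_sumr.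
rewrite exchange_big /= => E; apply: (mulfI c20); rewrite mulr0 -[RHS]E mulr_sumr.
apply: eq_bigr => s _.
have [xs|/v_out->] := eqVneq (gdist e x (enum_val s)) 2%N; last first.
  by rewrite mulr0 big1 // => t _; rewrite !mulr0.
transitivity ((\sum_(t | e x t) (gdist e (enum_val s) t == 1%N)%:R) * v s 0).
  congr (_ * _); rewrite (sum_nbr e_sym e_irr e_conn e_bip e_drg e_val diam_gt0 (fun j => (j == 1%N)%:R)).
  by rewrite (gdist_sym e_conn e_sym) xs /= mulr1 mulr0 addr0.
rewrite -[X in X * _ = _]sum_delta -[X in X * _ = _]sum_vertices mulr_suml; apply: eq_bigr => t _.
by rewrite !adjmx_entry // enum_rankK gdist_eq1 // [e (enum_val s) _]e_sym mulrA.
Qed.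

(** Splitting A a_i into raised and lowered parts gives a three-term recurrence, in which left
    multiplication by [E] turns [A] into the scalar [t]. The polynomial is chosen before [E] and
    [t], so one [q] serves all eigenvalues. *)
Lemma left_eigen_a m : (m + 2 <= diameter e)%N -> (forall j, (j < m)%N -> a j != 0) ->
  exists2 q : {poly C}, size q = m.+1 &
    forall (E : 'M[C]_#|X|) t, E *m A = t *: E -> E *m a m = q.[t] *: (E *m v).
Proof.
pose P i := exists2 q : {poly C}, size q = i.+1 &
    forall (E : 'M[C]_#|X|) t, E *m A = t *: E -> E *m a i = q.[t] *: (E *m v).
have P0 : P 0%N by exists 1; rewrite ?size_poly1 // => E t _; rewrite a0E hornerC scale1r.
(* Here [b *: r] represents the lowered part of A a_i: zero for i = 0, and a multiple of the
   polynomial of a_{i-1} afterwards. Its degree is too small to cancel the leading term of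
   [q * 'X]. *)
have step i (q r : {poly C}) b : size q = i.+1 -> (size r <= i.+1)%N -> (i.+1 + 2 <= diameter e)%N ->
    (forall (E : 'M[C]_#|X|) t, E *m A = t *: E -> E *m a i = q.[t] *: (E *m v)) ->
    (forall (E : 'M[C]_#|X|) t, E *m A = t *: E ->
       E *m (Es i.+1 *m (A *m a i)) = (b * r.[t]) *: (E *m v)) -> P i.+1.
  move=> sq sr iD qP rP.
  have ci : c i.+1 != 0.
    by rewrite pnatr_eq0 -lt0n (cnum_gt0 e_sym e_irr e_conn e_drg diam_gt0 x) //; lia.
  have q0 : q != 0 by rewrite -size_poly_eq0 sq.
  exists ((c i.+1)^-1 *: (q * 'X - b *: r)).
    rewrite size_scale ?invr_eq0 // size_polyDl size_mulX // sq //.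
    by rewrite size_polyN ltnS (leq_trans (size_scale_leq _ _)).
  move=> E t Et; rewrite -[a i.+1](scalerK ci) -raise_a -scalemxAr hornerZ -scalerA; congr (_ *: _).
  have -> : Es i.+3 *m (A *m a i) = A *m a i - Es i.+1 *m (A *m a i).
    by rewrite [X in _ = X - _](@adj_sphere i.+1) ?addrK // -addn2 sphere_a.
  rewrite mulmxBr (rP E t Et) (mulmxA E) Et -scalemxAl (qP E t Et) scalerA -scalerBl !hornerE.
  by congr (_ *: _); rewrite mulrC.
elim/ltn_ind: m => -[//|[|m]] IH mD nz.
  have [q sq qP] := P0; apply: (step 0%N q 0 0) => //; first by rewrite size_poly0.
  by move=> E t _; rewrite a0E lower_a0 mulmx0 mul0r scale0r.
have [|j jm|q sq qP] := IH m.+1 (ltnSn _); [by lia | by apply: nz; lia |].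
have [|j jm|r sr rP] := IH m (ltnW (ltnSn _)); [by lia | by apply: nz; lia |].
have [||b Eb] := @lower_a m; [by lia | by apply: nz; lia |].
apply: (step m.+1 q r b) => //; first by rewrite sr.
by move=> E t Et; rewrite Eb -scalemxAr (rP E t Et) scalerA.
Qed.

Lemma a_basis : (forall i, (i + 2 <= diameter e)%N -> a i != 0) ->
  basis_of W [seq a i | i <- iota 0 (diameter e).-1].
Proof.
move=> nz; set s := map _ _.
have s_free m n : (m + n <= (diameter e).-1)%N -> free [seq a i | i <- iota m n].
  elim: n m => [|n IH] m mn /=; first exact: nil_free.
  rewrite free_cons IH ?andbT; last by lia.
  have mD : (m + 2 <= diameter e)%N by lia.
  move: (nz m mD); apply: contra.
  (* [Es (m + 2)] kills all later vectors of the list but fixes [a m], which therefore lies outside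
     their span. *)
  have : (<<[seq a i | i <- iota m.+1 n]>> <= lker (linfun (mulmx (Es (m + 2)%N))))%VS.
    apply/span_subvP => u /mapP[i]; rewrite mem_iota => /andP[mi _] ->.
    rewrite memv_ker lfunE /= -!mulmxA dual_idemM.
    by have -> : (m + 2 == i + 2)%N = false by lia.
  by move=> /subvP sub /sub; rewrite memv_ker lfunE /= sphere_a.
rewrite /basis_of s_free // andbT eqEsubv; apply/andP; split; apply/subvP.
  apply/subvP/span_subvP => u /mapP[i]; rewrite mem_iota => /andP[_ iD] ->.
  have iD' : (i + 2 <= diameter e)%N by lia.
  by have := a_in iD'; rewrite mem_subconst // => /andP[].
move=> w wW; rewrite (sum_dual_idem w); apply: rpred_sum => -[i /=]; rewrite ltnS => iD _.
have : Es i *m w \in subconst e x i W.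
  by rewrite mem_subconst // dual_idemM !eqxx andbT; rewrite dual_idem_mem.
(* The endpoint kills the components in spheres 0 and 1; every other component lies on the line of
   some [a i]. *)
case: i iD => [|[|i]] iD.
- by have [_ _ ->] := W_end; rewrite // memv0 => /eqP->; apply: mem0v.
- by have [_ _ ->] := W_end; rewrite // memv0 => /eqP->; apply: mem0v.
rewrite -addn2 in iD *; move=> /(subconst_line iD (nz i iD) (a_in iD))[b ->].
by apply/memvZ/memv_span/map_f; rewrite mem_iota; lia.
Qed.

End ThinModule.

(** * The bounds on the local eigenvalue, and the conclusion *)

(** Otherwise s is nonzero and h = - B / s. If s < 0 then lo <= s < 0 gives h >= - B / lo; if s > 0
    then 0 < s <= hi gives h <= - B / hi. *)
Lemma tilde_gap (C : numClosedFieldType) (B h s lo hi : C) : 0 < B -> s \is Num.real ->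
  lo <= s -> s <= hi -> - (B / hi) < h -> h < - (B / lo) -> B + h * s != 0.
Proof.
move=> B0 sR lo_s s_hi h_gt h_lt; apply/eqP => E.
have [s0|s0|s0] := real_ltgtP sR (real0 C).
- have hE : h = - (B / s).
    by apply: (mulIf (ltr0_neq0 s0)); rewrite mulNr mulfVK ?ltr0_neq0 //; apply: (addrI B); rewrite E subrr.
  have lo0 : lo < 0 := le_lt_trans lo_s s0.
  have : - (B / lo) <= h by rewrite hE lerN2 ler_pM2l // lef_nV2.
  by move/(lt_le_trans h_lt); rewrite ltxx.
- have hE : h = - (B / s).
    by apply: (mulIf (lt0r_neq0 s0)); rewrite mulNr mulfVK ?lt0r_neq0 //; apply: (addrI B); rewrite E subrr.
  have hi0 : 0 < hi := lt_le_trans s0 s_hi.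
  have : h <= - (B / hi) by rewrite hE lerN2 ler_pM2l // lef_pV2.
  by move/(lt_le_trans h_gt); rewrite ltxx.
by move: E; rewrite s0 mulr0 addr0 => /eqP; rewrite gt_eqF.
Qed.

Theorem theorem16p4 (C : numClosedFieldType) (X : finType) (e : rel X)
    (p : nat -> nat -> nat -> nat) (D k : nat) (theta : nat -> C)
    (x : X) (W : {vspace 'cV[C]_#|X|}) (eta : C) (v : 'cV[C]_#|X|)
    (e_sym : symmetric e) (e_irr : irreflexive e) (e_conn : connected e)
    (e_bip : bipartite e) (e_drg : distance_regular e p)
    (e_diam : diameter e = D) (D_ge4 : (4 <= D)%N)
    (e_val : regular e k) (k_ge3 : (3 <= k)%N)
    (theta_eig : graph_eigenvalues e theta)
    (W_irr : T_irreducible e x W) (W_thin : thin e x W)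
    (W_end : has_endpoint e x W 2) (W_eta : local_eigenvalue e x W eta)
    (eta_gt : tilde p (theta 1%N) < eta)
    (eta_lt : eta < tilde p (theta D./2))
    (v_in : v \in subconst e x 2 W) (v_neq0 : v != 0) :
  basis_of W
    [seq dual_idem C e x (i + 2)%N *m distmx C e i *m v | i <- iota 0 D.-1].
Proof.
have D0 : (0 < diameter e)%N by lia.
have D1 : (1 < diameter e)%N by lia.
have [W_mod _ _] := W_irr; have [theta_dec theta_spec] := theta_eig.
rewrite -e_diam; apply: (a_basis e_sym e_irr e_conn e_bip e_drg e_val D1 W_mod W_thin W_end v_in) => m mD.
set a := fun i => dual_idem C e x (i + 2)%N *m distmx C e i *m v.
rewrite -/(a m).
have eig i : (i <= D)%N -> eigenvalue (adjmx C e) (theta i).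
  by move=> iD; apply/theta_spec; exists i; rewrite e_diam.
have dec i j : (i < j)%N -> (j <= D)%N -> theta j < theta i.
  by rewrite -e_diam; apply: theta_dec.
have opp i : (i <= D)%N -> exists2 j, (j <= D)%N & theta j = - theta i.
  move=> /eig/(eigenvalue_opp e_sym e_irr e_conn e_bip)/theta_spec[j []].
  by rewrite e_diam => jD Ej; exists j.
(* The valency is an eigenvalue, hence at most theta_0; the norm bound gives the converse. *)
have theta0 : theta 0%N = k%:R.
  have /theta_spec[j []] := eigenvalue_valency C e_sym e_irr e_conn e_val x.
  rewrite e_diam => jD Ej; apply/le_anti; rewrite -{2}Ej (theta_nincr dec) //= andbT.
  have t0 := eigenvalue_norm e_sym e_irr e_conn e_val (eig 0%N isT).
  apply: le_trans t0; apply: real_ler_norm.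
  exact: theta_real dec opp _ _.
have v2 : dual_idem C e x 2 *m v = v.
  by move: v_in; rewrite (mem_subconst W_mod) // => /andP[_ /eqP].
(* The local eigenvalue is attached to some vector of E*_2 W; thinness makes [v] a multiple of
   it. *)
have eta_v : dual_idem C e x 2 *m distmx C e 2 *m dual_idem C e x 2 *m v = eta *: v.
  have [w [wW w0 wE]] := W_eta.
  have [b ->] := subconst_line W_thin D1 w0 wW v_in.
  by rewrite -scalemxAr wE !scalerA mulrC.
have v_sum := sum_v e_sym e_irr e_conn e_bip e_drg e_val D1 W_mod W_end v_in.
have [|b2E b20] := bnumE e_sym e_irr e_conn e_bip e_drg e_val D0 x (_ : (2 < diameter e)%N).
  by lia.
have [|b3E b30] := bnumE e_sym e_irr e_conn e_bip e_drg e_val D0 x (_ : (3 < diameter e)%N).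
  by lia.
have E_exists i : (0 < i < D)%N -> exists2 E : 'M[C]_#|X|,
    E *m adjmx C e = theta i *: E & E *m v != 0.
  move=> /[dup] iD' /andP[i0 /ltnW iD].
  apply: (eigenmx_nonzero e_sym e_irr e_conn e_bip e_drg e_val D0 _ (eig i iD) _ _ v_neq0 v2 v_sum eta_v).
  - by lia.
  - by rewrite -theta0 lt_eqF // (theta_sqr_lt dec opp).
  (* With B = b_2 b_3, h = 1 + eta and s = theta_i^2 - b_2, the two bounds on h are the [tilde]
     values of theta_1 and theta_d, plus 1. *)
  apply: (@tilde_gap _ _ _ _ (theta D./2 ^+ 2 - (bnum p 2)%:R) (theta 1%N ^+ 2 - (bnum p 2)%:R)).
  - by rewrite mulr_gt0 ?ltr0n.
  - by rewrite rpredB ?rpredX ?(theta_real dec opp) ?realn.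
  - by rewrite lerD2r (theta_sqr_ge dec opp).
  - by rewrite lerD2r (theta_sqr_le dec opp).
  - by rewrite -ltrBlDl addrC.
  by rewrite -ltrBrDl addrC.
(* The least index n of a vanishing vector has all earlier vectors nonzero, as the polynomial of
   degree n requires. *)
apply/negP => am0; have [n an0 n_min] := ex_minnP (ex_intro (fun i => a i == 0) m am0).
have nD : (n + 2 <= diameter e)%N by have := n_min m am0; lia.
have a_nz j : (j < n)%N -> a j != 0.
  by move=> jn; apply/negP => /n_min; rewrite leqNgt jn.
have [q sq qP] :=
  left_eigen_a e_sym e_irr e_conn e_bip e_drg e_val D1 W_mod W_thin W_end v_in nD a_nz.
have q0 : q != 0 by rewrite -size_poly_eq0 sq.
(* E a_n = 0 while E v is nonzero, so theta_1, ..., theta_{D-1} are D - 1 distinct roots of a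
   polynomial of degree n <= D - 2. *)
have : all (root q) [seq theta i | i <- iota 1 D.-1].
  apply/allP => t /mapP[i]; rewrite mem_iota => i_in ->.
  have [|E EA Ev] := E_exists i; first by lia.
  have /esym/eqP := qP E _ EA; rewrite -/(a n) (eqP an0) mulmx0.
  by rewrite scaler_eq0 (negPf Ev) orbF.
move=> /(max_poly_roots q0); rewrite size_map size_iota sq.
suff u : uniq [seq theta i | i <- iota 1 D.-1] by move=> /(_ u); lia.
rewrite map_inj_in_uniq ?iota_uniq // => i j; rewrite !mem_iota => i_in j_in tij.
have [ij|ij|//] := ltngtP i j.
  by have := dec i j ij; rewrite tij ltxx => H; suff : false by []; apply: H; lia.
by have := dec j i ij; rewrite tij ltxx => H; suff : false by []; apply: H; lia.
Qed.
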